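(* Let $\mathfrak{B}$ be a bornology on a metric space $X$ with a closed base $\mathfrak{B}_0$, let $\mathcal{I},\mathcal{J}$ be ideals on $\omega$, and let $\square\in\{1\text{-}1,KB,K\}$. The following statements hold. (1) If $|\mathfrak{B}_0|<\mathfrak{p}_\square(\mathcal{I},\mathcal{J})$, then $[\mathcal{I}\text{-}\Gamma_{\mathfrak{B}^s},\mathcal{J}\text{-}\Gamma_{\mathfrak{B}^s}]_\square$ holds. (2) If $|\mathfrak{B}_0|<\mathfrak{p}_\square(\mathcal{J})$, then $[\mathcal{O}_{\mathfrak{B}^s},\mathcal{J}\text{-}\Gamma_{\mathfrak{B}^s}]_\square$ holds, provided $X$ is $\mathfrak{B}^s$-Lindelöf.
   Context: $(X,d)$ is an infinite metric space; $\omega$ is the set of natural numbers. A bornology $\mathfrak{B}$ on $X$ is a family of subsets of $X$ that is closed under subsets and finite unions and covers $X$. A base of $\mathfrak{B}$ is a subfamily $\mathfrak{B}_0\subseteq\mathfrak{B}$ such that every $B\in\mathfrak{B}$ is contained in some $B_0\in\mathfrak{B}_0$; it is a closed base if its members are closed. For $B\in\mathfrak{B}$, $\delta>0$: $B^\delta=\bigcup_{x\in B}\{y\in X:d(x,y)<\delta\}$. An ideal on $\omega$ is a family $\mathcal{I}\subseteq\mathcal{P}(\omega)$ closed under subsets and finite unions, containing all finite sets, with $\omega\notin\mathcal{I}$. Covers of $X$ never contain $X$ as an element. A cover $\mathcal{U}$ of $X$ is a $\mathfrak{B}^s$-cover if for each $B\in\mathfrak{B}$ there are $U\in\mathcal{U}$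 and $\delta>0$ with $B^\delta\subseteq U$; it is an open $\mathfrak{B}^s$-cover if its members are open. $\mathcal{O}_{\mathfrak{B}^s}$ is the class of open $\mathfrak{B}^s$-covers of $X$. $X$ is $\mathfrak{B}^s$-Lindelöf if every $\mathfrak{B}^s$-cover of $X$ contains a countable subset which is a $\mathfrak{B}^s$-cover of $X$. A countable open cover $\{U_n:n\in\omega\}$ (with its enumeration) is an $\mathcal{I}$-$\gamma_{\mathfrak{B}^s}$-cover if for each $B\in\mathfrak{B}$ there is a sequence $\{\delta_n\}$ of positive reals with $\{n\in\omega:B^{\delta_n}\nsubseteq U_n\}\in\mathcal{I}$; $\mathcal{I}\text{-}\Gamma_{\mathfrak{B}^s}$ is the class of these. A function $\phi:\omega\to\omega$ is a $1\text{-}1$-function, $KB$-function, $K$-function if it is one-to-one, finite-to-one, arbitrary, respectively. For $\mathcal{A}_1,\mathcal{A}_2\subseteq\mathcal{P}(\omega)$, $\mathcal{A}_1\leq_\square\mathcal{A}_2$ means there is a $\square$-function $\phi$ with $\phi^{-1}(A)\in\mathcal{A}_2$ for all $A\in\mathcal{A}_1$. Define $\mathfrak{p}_\square(\mathcal{I},\mathcal{J})=\min\{|\mathcal{A}|:\mathcal{A}\subseteq\mathcal{I},\ \mathcal{A}\nleq_\square\mathcal{J}\}$ (with $\min\emptyset=\infty$) and $\mathfrak{p}_\square(\mathcal{J})=\min\{\mathfrak{p}_\square(\mathcal{I},\mathcal{J}):\mathcal{I}\text{ an ideal on }\omega\}$. $[\mathcal{P},\mathcal{R}]_\square$: for every sequence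 $\{V_n:n\in\omega\}\in\mathcal{P}$ there is a $\square$-function $\phi:\omega\to\omega$ such that $\{V_{\phi(n)}:n\in\omega\}\in\mathcal{R}$. *)

(* Defs.v *)
From HB Require Import structures.
From mathcomp Require Import all_boot all_order all_algebra.
From mathcomp Require Import all_classical all_reals all_analysis.

Set Implicit Arguments.
Unset Strict Implicit.
Unset Printing Implicit Defensive.

Import Order.TTheory GRing.Theory Num.Theory.

Local Open Scope classical_set_scope.
Local Open Scope card_scope.
Local Open Scope ring_scope.

Section Covers.
Context {R : realType} {X : metricType R}.
Implicit Types (Bo C : set (set X)) (B : set X).

Definition bornology Bo : Prop :=
  [/\ forall A B, Bo B -> A `<=` B -> Bo A,
      forall A B, Bo A -> Bo B -> Bo (A `|` B) &
      \bigcup_(B in Bo) B = [set: X]].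

Definition closed_base Bo (Bo0 : set (set X)) : Prop :=
  [/\ Bo0 `<=` Bo,
      forall B, Bo B -> exists2 B0, Bo0 B0 & B `<=` B0 &
      forall B0, Bo0 B0 -> closed B0].

Definition enlargement B (delta : R) : set X :=
  \bigcup_(x in B) [set y | mdist x y < delta].

Definition is_cover C : Prop :=
  \bigcup_(U in C) U = [set: X] /\ ~ C [set: X].

Definition Bs_cover Bo C : Prop :=
  is_cover C /\
  forall B, Bo B ->
    exists2 U, C U & exists2 delta : R, 0 < delta & enlargement B delta `<=` U.

Definition open_Bs_cover Bo : set (set (set X)) :=
  [set C | Bs_cover Bo C /\ C `<=` open].

Definition Bs_Lindelof Bo : Prop :=
  forall C, Bs_cover Bo C ->
    exists C', [/\ C' `<=` C, countable C' & Bs_cover Bo C'].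

(* A countable cover is represented by its enumeration, which may repeat
   members. *)
Definition gamma_Bs_cover (I : set (set nat)) Bo : set (nat -> set X) :=
  [set U | [/\ is_cover (range U), range U `<=` open &
    forall B, Bo B -> exists2 delta : nat -> R, (forall n, 0 < delta n) &
      I [set n | ~ enlargement B (delta n) `<=` U n]]].

Definition sequences_of (Cs : set (set (set X))) : set (nat -> set X) :=
  [set U | Cs (range U)].

End Covers.

Definition ideal (I : set (set nat)) : Prop :=
  [/\ forall A B, I B -> A `<=` B -> I A,
      forall A B, I A -> I B -> I (A `|` B),
      forall A, finite_set A -> I A &
      ~ I [set: nat]].

Inductive fun_kind : Set := OneToOne | KB | K.

Definition is_fun (sq : fun_kind) (phi : nat -> nat) : Prop :=
  match sq with
  | OneToOne => injective phi
  | KB => forall n, finite_set (phi @^-1` [set n])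
  | K => True
  end.

Definition le_fun (sq : fun_kind) (A1 A2 : set (set nat)) : Prop :=
  exists2 phi, is_fun sq phi & forall A, A1 A -> A2 (phi @^-1` A).

Definition selection (sq : fun_kind) (X : Type) (P Q : set (nat -> set X)) :
    Prop :=
  forall V, P V -> exists2 phi, is_fun sq phi & Q (V \o phi).

(* Cardinals of families of subsets of nat, extended with infinity:
   [Some A] stands for the cardinal of the family [A], [None] for infinity.
   Two families of the same cardinality represent the same cardinal. *)
Definition xcard := option (set (set nat)).

Definition xcard_le (c d : xcard) : Prop :=
  match c, d with
  | _, None => True
  | None, Some _ => False
  | Some A, Some B => A #<= B
  end.

Definition xcard_min (S : set xcard) : xcard :=
  xget None [set c | S c /\ forall d, S d -> xcard_le c d].

(* |S| < c *)
Definition card_lt_xcard (T : Type) (S : set T) (c : xcard) : Prop :=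
  match c with
  | None => True
  | Some A => S #<= A /\ ~ (A #<= S)
  end.

Definition p_pair (sq : fun_kind) (I J : set (set nat)) : xcard :=
  xcard_min [set Some A | A in [set A | A `<=` I /\ ~ le_fun sq A J]].

Definition p_single (sq : fun_kind) (J : set (set nat)) : xcard :=
  xcard_min [set p_pair sq I J | I in ideal].

(* Cardinals are well-ordered, so [xcard_min] is a genuine minimum. *)
Lemma card_le_min (T : Type) (S : set (set T)) : S !=set0 ->
  exists2 A, S A & forall B, S B -> A #<= B.
Proof.
move=> [S0 SS0].
have [[t0]|noT] := pselect (exists t : T, True); last first.
  exists S0 => // B SB; rewrite (_ : S0 = set0) ?card_ge0//.
  by apply/seteqP; split=> // t; case: noT; exists t.
pose P (G : set (set T -> T)) :=
  (forall g, G g -> forall B, S B -> B (g B)) /\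
  (forall B, S B -> forall f g, G f -> G g -> f B = g B -> f = g).
have [|G [[PG1 PG2] Gmax]] := @Zorn_bigcup _ P.
  move=> F FP tF; split.
    by move=> g [G FG Gg] B SB; have [h _] := FP _ FG; exact: h _ Gg _ SB.
  move=> B SB f g [G1 FG1 G1f] [G2 FG2 G2g].
  have [G12|G21] := tF _ _ FG1 FG2.
    by have [_ h] := FP _ FG2; apply: (h _ SB) => //; exact: G12.
  by have [_ h] := FP _ FG1; apply: (h _ SB) => //; exact: G21.
have [A SA AG] : exists2 A, S A & A `<=` (fun g => g A) @` G.
  apply: contrapT => noA.
  have /choice[f fP] : forall B, exists t : T,
      S B -> B t /\ forall g, G g -> g B <> t.
    move=> B; have [SB|] := pselect (S B); last by exists t0.
    apply: contrapT => noB; apply: noA; exists B => // t Bt.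
    apply: contrapT => nt; apply: noB; exists t => _; split => // g Gg gBt.
    by apply: nt; exists g.
  apply: (Gmax (G `|` [set f])).
    split=> [g Gg|sub]; first by left.
    by have [_ h] := fP _ SS0; case: (h f) => //; apply: sub; right.
  split.
    by move=> g [Gg|->] B SB; [exact: PG1 _ Gg _ SB|have [] := fP _ SB].
  move=> B SB g h [Gg|->] [Gh|->] // e.
  - exact: (PG2 _ SB).
  - by case: ((fP _ SB).2 _ Gg).
  - by case: ((fP _ SB).2 _ Gh).
exists A => // B SB.
apply: (card_le_trans (subset_card_le AG)).
apply: (card_le_trans (card_image_le _ _)).
have GB : (fun g => g B) @` G #= G.
  by apply: inj_card_eq => f g /set_mem Gf /set_mem Gg; exact: PG2.
have : (fun g => g B) @` G `<=` B by move=> _ [g Gg <-]; exact: PG1 _ Gg _ SB.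
by move=> /subset_card_le; apply: card_le_trans; move: GB; rewrite card_eq_le => /andP[].
Qed.

Lemma xcard_minP (S : set xcard) : S !=set0 ->
  S (xcard_min S) /\ forall c, S c -> xcard_le (xcard_min S) c.
Proof.
move=> S0; apply: (@xgetPex _ None [set c | S c /\ _]).
have [[A0 SA0]|noA] := pselect (exists A, S (Some A)).
  have [|A SA Amin] := @card_le_min _ [set A | S (Some A)]; first by exists A0.
  by exists (Some A); split=> // -[B|] //; exact: Amin.
have [[A|] Sc] := S0; first by case: noA; exists A.
by exists None; split=> // -[B SB|//]; case: noA; exists B.
Qed.

(* Main.v *)
Require Import Defs.
From mathcomp Require Import all_boot all_order all_algebra.
From mathcomp Require Import all_classical all_reals all_analysis.

(** For an enumeration [V] of open proper subsets and a bounded set [B], let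
    the defect of [V] at [B] be the set of indices [n] such that no uniform
    enlargement of [B] fits in [V n].  Choosing the radii index by index shows
    that [V] is an [I]-gamma cover exactly when all its defects belong to [I]
    ([gamma_Bs_coverP]).  Two features of defects drive the proof: they grow
    with [B], so those at a base control all the others, and the defect of
    [V \o phi] is the preimage under [phi] of the defect of [V].

    For the first part, the defects of [V] at the members of the base form a
    subfamily of [I] of size at most that of the base, hence smaller than the
    pseudo-intersection number of [I] and [J].  Some [phi] therefore pulls all
    of them back into [J], and [V \o phi] is the required selection.

    The second part reduces to the first, because every enumerated open cover
    in the strong sense is already an [I]-gamma cover for a suitable ideal [I],
    and [p_single sq J] is below [p_pair sq I J].  The ideal is generated by
    the defects and the finite sets; it is proper because the complement of a
    defect is always infinite ([infinite_defectC]): adding to [B] one point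
    outside each of finitely many members of the cover disqualifies them all,
    while the enlarged bounded set must still fit in some member. *)

Local Open Scope classical_set_scope.
Local Open Scope card_scope.
Local Open Scope ring_scope.

(** * Comparing with pseudo-intersection numbers *)

Lemma card_lt_le_xcard (T : Type) (S : set T) (c d : xcard) :
  card_lt_xcard S c -> xcard_le c d -> card_lt_xcard S d.
Proof.
case: c d => [A|] [B|] //= [SA nAS] AB; split; first exact: card_le_trans AB.
by move=> BS; apply: nAS; exact: card_le_trans BS.
Qed.

Lemma le_fun_lt_p_pair (sq : fun_kind) (I J : set (set nat)) (T : Type)
    (S : set T) (A : set (set nat)) :
  card_lt_xcard S (p_pair sq I J) -> A `<=` I -> A #<= S -> le_fun sq A J.
Proof.
move=> ltS AI AS; apply: contrapT => nA.
set C := [set Some B | B in [set B | B `<=` I /\ ~ le_fun sq B J]].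
have CA : C (Some A) by exists A.
have [_ /(_ _ CA) minA] := @xcard_minP C (ex_intro _ _ CA).
by have [_] := card_lt_le_xcard _ _ _ _ ltS minA.
Qed.

Lemma p_single_le_p_pair (sq : fun_kind) (I J : set (set nat)) :
  ideal I -> xcard_le (p_single sq J) (p_pair sq I J).
Proof.
move=> idI; set C := [set p_pair sq I' J | I' in ideal].
have CI : C (p_pair sq I J) by exists I.
by have [_] := @xcard_minP C (ex_intro _ _ CI); exact.
Qed.

(** * Defects *)

Section Defect.
Context {R : realType} {X : metricType R}.
Implicit Types (Bo : set (set X)) (V : nat -> set X) (B : set X).
Implicit Types I J : set (set nat).

Definition defect V B : set nat :=
  [set n | forall delta : R, 0 < delta -> ~ enlargement B delta `<=` V n].

Lemma enlargementS (A B : set X) (delta : R) :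
  A `<=` B -> enlargement A delta `<=` enlargement B delta.
Proof. by move=> AB y [x Ax xy]; exists x => //; exact: AB. Qed.

Lemma sub_enlargement B (delta : R) : 0 < delta -> B `<=` enlargement B delta.
Proof. by move=> d0 x Bx; exists x => //=; rewrite mdistxx. Qed.

Lemma defectS V (A B : set X) : A `<=` B -> defect V A `<=` defect V B.
Proof.
move=> AB n dA delta d0 BV; apply: (dA _ d0).
exact: subset_trans (enlargementS _ _ _ AB) BV.
Qed.

Lemma defectC V B n : (~` defect V B) n ->
  exists2 delta : R, 0 < delta & enlargement B delta `<=` V n.
Proof.
move=> ndn; apply: contrapT => nex; apply: ndn => delta d0 BV.
by apply: nex; exists delta.
Qed.

Lemma defectC_sub V B n : (~` defect V B) n -> B `<=` V n.
Proof.
move=> /defectC[delta d0]; apply: subset_trans; exact: sub_enlargement.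
Qed.

Lemma bornology1 Bo (x : X) : bornology Bo -> Bo [set x].
Proof.
case=> BoS _ BoT; have [B BoB Bx] : (\bigcup_(B in Bo) B) x by rewrite BoT.
by apply: BoS BoB _ => _ ->.
Qed.

Lemma bornology_setU_finite Bo B (F : set nat) (x : nat -> X) :
  bornology Bo -> Bo B -> finite_set F -> Bo (B `|` x @` F).
Proof.
move=> bBo BoB finF; have [BoS BoU _] := bBo.
have [s ->] : exists s : seq nat, F = [set` s] by exact/finite_seqP.
elim: s => [|n s IH].
  by apply: BoS BoB _ => y [|[m]] //=; rewrite in_nil.
apply: BoS (BoU _ _ IH (bornology1 _ (x n) bBo)) _ => y [By|[m]].
  by left; left.
rewrite /= inE => /orP[/eqP -> <-|ms <-]; first by right.
by left; right; exists m.
Qed.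

(** The covering requirement is absorbed by properness of [J]: the defect at a
    singleton is not all of [nat], so its point is covered. *)
Lemma gamma_Bs_coverP J Bo V : ideal J -> bornology Bo ->
  gamma_Bs_cover J Bo V <->
  [/\ ~ range V [set: X], range V `<=` open &
      forall B, Bo B -> J (defect V B)].
Proof.
move=> [JS _ _ JT] bBo; split.
  move=> [[_ VT] oV gV]; split => // B /gV[delta d0 Jd].
  by apply: JS Jd _ => n; apply; exact: d0.
move=> [VT oV dV]; split => //.
  split => //; apply/seteqP; split => // x _.
  have [n dn] : exists n, (~` defect V [set x]) n.
    apply: contrapT => nex; apply: JT.
    apply: JS (dV _ (bornology1 _ x bBo)) _ => n _.
    by apply: contrapT => dn; apply: nex; exists n.
  by exists (V n); [exists n|exact: (defectC_sub _ _ _ dn)].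
move=> B BoB.
(* On the defect any radius will do; 1 is taken there. *)
have /choice[delta deltaP] : forall n, exists d : R,
    0 < d /\ ((~` defect V B) n -> enlargement B d `<=` V n).
  move=> n; have [dn|/defectC[d d0 BV]] := pselect (defect V B n).
    by exists 1; split.
  by exists d; split.
exists delta => [n|]; first by have [] := deltaP n.
apply: JS (dV _ BoB) _ => n nBV; apply: contrapT => dn; apply: nBV.
by have [_] := deltaP n; exact.
Qed.

(** * Selecting a gamma cover *)

Lemma gamma_selection Bo (Bo0 : set (set X)) I J (sq : fun_kind) :
  bornology Bo -> closed_base Bo Bo0 -> ideal I -> ideal J ->
  card_lt_xcard Bo0 (p_pair sq I J) ->
  selection sq (gamma_Bs_cover I Bo) (gamma_Bs_cover J Bo).
Proof.
move=> bBo [Bo0S Bo0P _] idI idJ ltBo0 V.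
move=> /(gamma_Bs_coverP _ _ _ idI bBo)[VT oV dV].
have dI : defect V @` Bo0 `<=` I by move=> _ [B /Bo0S BoB <-]; exact: dV.
have [phi kphi phiJ] :=
  le_fun_lt_p_pair _ _ _ _ _ _ ltBo0 dI (card_image_le _ _).
exists phi => //; apply/(gamma_Bs_coverP _ _ _ idJ bBo); split.
- by move=> [n _ Vn]; apply: VT; exists (phi n).
- by move=> _ [n _ <-]; apply: oV; exists (phi n).
move=> B /Bo0P[B0 Bo0B0 BB0]; have [JS _ _ _] := idJ.
apply: (JS _ (phi @^-1` defect V B0)); first by apply: phiJ; exists B0.
by move=> n /(defectS _ _ _ BB0).
Qed.

(** * The ideal generated by the defects of a cover *)

(** If only finitely many [V n] contained an enlargement of [B], then adding to
    [B] a point outside each of them would give a bounded set no enlargement of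
    which fits in any member of the cover. *)
Lemma infinite_defectC Bo V B : bornology Bo -> Bs_cover Bo (range V) ->
  Bo B -> infinite_set (~` defect V B).
Proof.
move=> bBo [[_ VT] cV] BoB finD.
have /choice[x xP] : forall n, exists x, ~ V n x.
  move=> n; apply: contrapT => nex; apply: VT; exists n => //.
  apply/seteqP; split => // x _.
  by apply: contrapT => Vx; apply: nex; exists x.
(* [x n] is the point that disqualifies [V n]. *)
set B' := B `|` x @` (~` defect V B).
have BoB' : Bo B' by exact: bornology_setU_finite.
have [_ [n _ <-] [delta d0 B'V]] := cV _ BoB'.
have dB'n : (~` defect V B') n by move=> /(_ _ d0); exact.
apply: (xP n); apply: (defectC_sub _ _ _ dB'n); right; exists n => //.
by move=> dBn; apply: dB'n; apply: defectS dBn; exact: subsetUl.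
Qed.

(** The ideal generated by the defects and the finite sets.  A single defect
    can stand for a finite union of them, since bounded sets are closed under
    union and defects are monotone. *)
Definition defect_ideal Bo V : set (set nat) :=
  [set A | exists2 B, Bo B & finite_set (A `\` defect V B)].

Lemma defect_idealP Bo V : Bo !=set0 -> bornology Bo ->
  Bs_cover Bo (range V) -> ideal (defect_ideal Bo V).
Proof.
move=> [C BoC] bBo cV; have [_ BoU _] := bBo; split.
- move=> A A' [B BoB finA'] AA'; exists B => //.
  by apply: sub_finite_set finA'; exact: setSD.
- move=> A A' [B BoB finA] [B' BoB' finA'].
  exists (B `|` B'); first exact: BoU.
  rewrite setDUl finite_setU; split.
    by apply: sub_finite_set finA; apply: setDS; exact: (defectS V _ _ (@subsetUl _ _ _)).
  by apply: sub_finite_set finA'; apply: setDS; exact: (defectS V _ _ (@subsetUr _ _ _)).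
- by move=> A finA; exists C => //; exact: finite_setD.
- by move=> [B BoB]; rewrite setTD; exact: infinite_defectC BoB.
Qed.

Lemma open_Bs_cover_gamma Bo V : Bo !=set0 -> bornology Bo ->
  sequences_of (open_Bs_cover Bo) V ->
  gamma_Bs_cover (defect_ideal Bo V) Bo V.
Proof.
move=> Bo_n0 bBo [cV oV].
apply/(gamma_Bs_coverP _ _ _ (defect_idealP _ _ Bo_n0 bBo cV) bBo); split => //.
  by have [[]] := cV.
by move=> B BoB; exists B => //; rewrite setDv; exact: finite_set0.
Qed.

End Defect.

Theorem theorem3p3 (R : realType) (X : metricType R)
    (X_infinite : infinite_set [set: X])
    (Bo Bo0 : set (set X)) (Bo_bornology : bornology Bo)
    (Bo0_base : closed_base Bo Bo0)
    (I J : set (set nat)) (I_ideal : ideal I) (J_ideal : ideal J)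
    (sq : fun_kind) :
  (card_lt_xcard Bo0 (p_pair sq I J) ->
     selection sq (gamma_Bs_cover I Bo) (gamma_Bs_cover J Bo)) /\
  (card_lt_xcard Bo0 (p_single sq J) ->
     Bs_Lindelof Bo ->
     selection sq (sequences_of (open_Bs_cover Bo)) (gamma_Bs_cover J Bo)).
Proof.
split=> [|ltBo0 _ V sV]; first exact: gamma_selection.
have Bo_n0 : Bo !=set0.
  have [x _] : [set: X] !=set0 by exact: infinite_setN0.
  by exists [set x]; exact: bornology1.
have idV : ideal (defect_ideal Bo V) by apply: defect_idealP; case: sV.
apply: (gamma_selection _ _ _ _ _ Bo_bornology Bo0_base idV J_ideal).
  exact: card_lt_le_xcard ltBo0 (p_single_le_p_pair _ _ _ idV).
exact: open_Bs_cover_gamma.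
Qed.
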